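(* Let $N$ be a surface with isothermal coordinate $u$ and conformal metric $h=e^{F(u,\bar u)}|du|^2$, with Gauss curvature $K_N=K_N(u,\bar u)=-2F_{u\bar u}e^{-F}$. Let $M$ be a domain with complex coordinate $\zeta=\xi+i\eta$ and let $u=u(\zeta,\bar\zeta):M\to N$ be a harmonic diffeomorphism for which $\zeta$ is the specific coordinate, i.e. $e^{F(u,\bar u)}u_\zeta\bar u_\zeta=1$. Let $\omega,\theta$ be smooth real-valued functions on $M$ such that $v=\omega+i\theta$ satisfies $e^{v}=e^{F(u,\bar u)/2}\,u_\zeta$. Then, with $F$ and its derivatives evaluated along $u(\zeta,\bar\zeta)$: (1) $\omega$ satisfies the sinh-Gordon equation \[ \omega_{\zeta\bar\zeta}=-\frac{K_N}{2}\sinh 2\omega ; \] (2) $\theta$ satisfies the equation \[ 2i\,\theta_{\zeta\bar\zeta}=e^{-F}\Bigl(\bigl(F_u^2-F_{uu}\bigr)e^{2i\theta}-\bigl(F_{\bar u}^2-F_{\bar u\bar u}\bigr)e^{-2i\theta}\Bigr); \] (3) $\omega$ and $\theta$ are related by the system of first order partial differential equations \[ \omega_\xi-\theta_\eta=\tfrac12\tanh\omega\,\frac{\partial F}{\partial\xi},\qquad \omega_\eta+\theta_\xi=\tfrac12\coth\omega\,\frac{\partial F}{\partial\eta}, \] where $\frac{\partial F}{\partial\xi}=F_u u_\xi+F_{\bar u}\bar u_\xi$ and $\frac{\partial F}{\partial\eta}=F_u u_\eta+F_{\bar u}\bar u_\eta$. That is, the equation $2i\,\theta_{\zeta\bar\zeta}=e^{-F}\bigl((F_u^2-F_{uu})e^{2i\theta}-(F_{\bar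 u}^2-F_{\bar u\bar u})e^{-2i\theta}\bigr)$ for $\theta$ is the Bäcklund transform of the sinh-Gordon equation $\omega_{\zeta\bar\zeta}=-\frac{K_N}{2}\sinh 2\omega$ for $\omega$, via the first order system $\omega_\xi-\theta_\eta=\tfrac12\tanh\omega\,\frac{\partial F}{\partial\xi}$, $\omega_\eta+\theta_\xi=\tfrac12\coth\omega\,\frac{\partial F}{\partial\eta}$.
   Context: Maps are written in isothermal coordinates as complex-valued functions. Notation: $\partial_\zeta=\frac12(\partial_\xi-i\partial_\eta)$, $\partial_{\bar\zeta}=\frac12(\partial_\xi+i\partial_\eta)$, and $\bar u_\zeta=\partial_\zeta\bar u=\overline{u_{\bar\zeta}}$. A map $u:M\to N$ into $(N,e^{F(u,\bar u)}|du|^2)$ is called harmonic if $u_{\zeta\bar\zeta}+F_u(u,\bar u)\,u_\zeta u_{\bar\zeta}=0$. For a harmonic map with nowhere vanishing holomorphic Hopf differential $e^{F}u_z\bar u_z\,dz^2=e^{-\lambda(z)}dz^2$, the ''specific coordinate'' on $M$ is $\zeta=\int e^{-\lambda(z)/2}dz$; in it $e^Fu_\zeta\bar u_\zeta=1$. The Jacobian of a diffeomorphism is nowhere vanishing, i.e. $|u_\zeta|^2\ne|u_{\bar\zeta}|^2$. A Bäcklund transformation is a system of first order partial differential equations relating the solution of one PDE to the solution of another PDE; one solution is then said to be the Bäcklund transform of the other. *)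

(* Defs.v *)
From Stdlib Require Import Reals.
From Coquelicot Require Import Coquelicot.
Open Scope R_scope.
Open Scope C_scope.

(** Points of the plane are [zeta = xi + i eta : C = R * R].  All derivatives
    are Coquelicot's total [Derive]; they are only used at points of an open
    set on which the functions are assumed smooth. *)

Definition is_domain (D : C -> Prop) : Prop :=
  open D /\ (exists z, D z) /\
  forall A B : C -> Prop, open A -> open B ->
    (forall z, D z -> A z \/ B z) ->
    (exists z, D z /\ A z) -> (exists z, D z /\ B z) ->
    exists z, D z /\ A z /\ B z.

(** For open [D], this is C^infinity on [D]: [ex_diff_n g n] asks for the
    existence and continuity of all partial derivatives up to order [n]. *)
Definition smooth_on (D : C -> Prop) (g : C -> R) : Prop :=
  forall z : C, D z ->
  forall n : nat, ex_diff_n (fun x y : R => g (x, y)) n (Re z) (Im z).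

Definition Csmooth_on (D : C -> Prop) (f : C -> C) : Prop :=
  smooth_on D (fun z => Re (f z)) /\ smooth_on D (fun z => Im (f z)).

Definition diffeomorphism (M N : C -> Prop) (u : C -> C) : Prop :=
  Csmooth_on M u /\ (forall z, M z -> N (u z)) /\
  exists g : C -> C,
    Csmooth_on N g /\ (forall w, N w -> M (g w)) /\
    (forall z, M z -> g (u z) = z) /\ (forall w, N w -> u (g w) = w).

Definition dxi (g : C -> R) (z : C) : R :=
  Derive (fun x : R => g (x, Im z)) (Re z).
Definition deta (g : C -> R) (z : C) : R :=
  Derive (fun y : R => g (Re z, y)) (Im z).

Definition Cdxi (f : C -> C) (z : C) : C :=
  (dxi (fun p => Re (f p)) z, dxi (fun p => Im (f p)) z).
Definition Cdeta (f : C -> C) (z : C) : C :=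
  (deta (fun p => Re (f p)) z, deta (fun p => Im (f p)) z).

Definition dzeta (f : C -> C) (z : C) : C :=
  / 2 * (Cdxi f z - Ci * Cdeta f z).
Definition dzetabar (f : C -> C) (z : C) : C :=
  / 2 * (Cdxi f z + Ci * Cdeta f z).

Definition Cbar (f : C -> C) (z : C) : C := Cconj (f z).
Definition Cfun (g : C -> R) (z : C) : C := RtoC (g z).

Definition Cexp (z : C) : C :=
  (exp (Re z) * cos (Im z), exp (Re z) * sin (Im z))%R.

Definition coth (x : R) : R := (cosh x / sinh x)%R.

(** Derivatives of the exponent of the metric [e^F |du|^2] with respect to the
    coordinate [u] of the target and its conjugate. *)
Definition F_u (F : C -> R) : C -> C := dzeta (Cfun F).
Definition F_ub (F : C -> R) : C -> C := dzetabar (Cfun F).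
Definition F_uu (F : C -> R) : C -> C := dzeta (F_u F).
Definition F_uub (F : C -> R) : C -> C := dzetabar (F_u F).
Definition F_ubub (F : C -> R) : C -> C := dzetabar (F_ub F).

Definition gauss_curvature (F : C -> R) (w : C) : C :=
  - 2 * F_uub F w * exp (- F w).

Definition harmonic_map (M : C -> Prop) (F : C -> R) (u : C -> C) : Prop :=
  forall z, M z ->
    dzetabar (dzeta u) z + F_u F (u z) * dzeta u z * dzetabar u z = 0.

Definition specific_coordinate
    (M : C -> Prop) (F : C -> R) (u : C -> C) : Prop :=
  forall z, M z -> exp (F (u z)) * dzeta u z * dzeta (Cbar u) z = 1.

Definition F_xi (F : C -> R) (u : C -> C) (z : C) : C :=
  F_u F (u z) * Cdxi u z + F_ub F (u z) * Cdxi (Cbar u) z.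
Definition F_eta (F : C -> R) (u : C -> C) (z : C) : C :=
  F_u F (u z) * Cdeta u z + F_ub F (u z) * Cdeta (Cbar u) z.

Definition sinh_gordon
    (M : C -> Prop) (F : C -> R) (u : C -> C) (omega : C -> R) : Prop :=
  forall z, M z ->
    dzetabar (dzeta (Cfun omega)) z
    = - (gauss_curvature F (u z) / 2) * sinh (2 * omega z).

Definition theta_equation
    (M : C -> Prop) (F : C -> R) (u : C -> C) (theta : C -> R) : Prop :=
  forall z, M z ->
    2 * Ci * dzetabar (dzeta (Cfun theta)) z
    = exp (- F (u z)) *
      ((F_u F (u z) ^ 2 - F_uu F (u z)) * Cexp (2 * Ci * theta z)
       - (F_ub F (u z) ^ 2 - F_ubub F (u z)) * Cexp (- (2 * Ci * theta z))).

(** [omega z <> 0] makes explicit that [coth (omega z)] is defined, so that the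
    second equation never involves the junk value of a division by zero. *)
Definition backlund_system (M : C -> Prop) (F : C -> R) (u : C -> C)
    (omega theta : C -> R) : Prop :=
  forall z, M z ->
    omega z <> 0%R /\
    RtoC (dxi omega z - deta theta z) = / 2 * tanh (omega z) * F_xi F u z /\
    RtoC (deta omega z + dxi theta z) = / 2 * coth (omega z) * F_eta F u z.

(** [theta], a solution of [E2], is the Baecklund transform of [omega], a
    solution of [E1], via the first order system [S]. *)
Definition backlund_transform (E1 E2 : (C -> R) -> Prop)
    (S : (C -> R) -> (C -> R) -> Prop) (omega theta : C -> R) : Prop :=
  E1 omega /\ E2 theta /\ S omega theta.

(* Main.v *)
(** Write [p = u_zeta], [q = u_zetabar].  Since [e^v = e^(F/2) p] and
    [e^F p (conj q) = 1], both derivatives are explicit in [v]; in particular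
    [q = e^(-2 omega) p].  Differentiating [e^v = e^(F/2) p] in [zetabar] and
    using the harmonic map equation gives
      [v_zetabar = (F_ub (conj p) - F_u q) / 2],
    whose real and imaginary parts are the first order system.  Differentiating
    once more in [zeta], with harmonicity again removing the second derivatives
    of [u], gives
      [v_(zeta zetabar) = (F_uub (|p|^2 - |q|^2) + T) / 2]
    with [T] purely imaginary.  The first summand is real because [F] is, so half
    of it is [omega_(zeta zetabar)], and [T / 2] is [i theta_(zeta zetabar)].  If
    [omega] vanished somewhere, [q = p] there, and the differential of [u] would
    not be invertible. *)

Require Import Defs.
From Stdlib Require Import Reals Lra.
From Coquelicot Require Import Coquelicot.
Open Scope R_scope.
Open Scope C_scope.

(** * Total differentials and Wirtinger derivatives *)

(** Total differentiability, not mere existence of partial derivatives: the chain rule needs it. *)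
Definition is_pd (g : C -> R) (z : C) (a b : R) : Prop :=
  differentiable_pt_lim (fun x y => g (x, y)) (Re z) (Im z) a b.

(** The differential of [f] at [z] is [h |-> p h + q (conj h)], so that [p] and
    [q] are the Wirtinger derivatives of [f]. *)
Definition is_wd (f : C -> C) (z p q : C) : Prop :=
  is_pd (fun w => Re (f w)) z (Re (p + q)) (Re (Ci * (p - q))) /\
  is_pd (fun w => Im (f w)) z (Im (p + q)) (Im (Ci * (p - q))).

(* [Re] and [Im] must become [fst] and [snd] for [field] to identify atoms. *)
Ltac parts := unfold Re, Im; simpl; field.

Lemma C_ext (a b : C) : Re a = Re b -> Im a = Im b -> a = b.
Proof. destruct a, b; simpl; congruence. Qed.

Lemma is_pd_ext_loc (f g : C -> R) (z : C) (a b : R) :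
  locally z (fun w => f w = g w) -> is_pd f z a b -> is_pd g z a b.
Proof.
  intros H; apply differentiable_pt_lim_ext, locally_2d_locally.
  destruct z as [x y]; revert H; apply filter_imp; now intros [s t].
Qed.

Lemma is_pd_unique (g : C -> R) (z : C) (a b : R) :
  is_pd g z a b -> dxi g z = a /\ deta g z = b.
Proof. exact (differentiable_pt_lim_unique _ _ _ _ _). Qed.

Lemma differentiable_fst (x y : R) :
  differentiable_pt_lim (fun s _ => s) x y 1 0.
Proof.
  apply (differentiable_pt_lim_proj1_0 (fun s => s)), derivable_pt_lim_id.
Qed.

Lemma differentiable_snd (f : R -> R) (x y l : R) :
  derivable_pt_lim f y l -> differentiable_pt_lim (fun _ t => f t) x y 0 l.
Proof.
  intros Hf eps.
  destruct (differentiable_pt_lim_proj1_0 f y x l Hf eps) as [d Hd].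
  exists d; intros s t Hs Ht.
  (* The projection lemma for the first coordinate is reused with the two coordinates exchanged. *)
  rewrite Rmax_comm, Rplus_comm; exact (Hd t s Ht Hs).
Qed.

Lemma differentiable_plus (x y : R) : differentiable_pt_lim Rplus x y 1 1.
Proof.
  intros eps; exists (mkposreal 1 Rlt_0_1); intros s t _ _.
  replace (s + t - (x + y) - (1 * (s - x) + 1 * (t - y)))%R with 0%R by ring.
  rewrite Rabs_R0; apply Rmult_le_pos; [apply Rlt_le, cond_pos|].
  eapply Rle_trans; [apply Rabs_pos | apply Rmax_l].
Qed.

Lemma differentiable_minus (x y : R) : differentiable_pt_lim Rminus x y 1 (-1).
Proof.
  intros eps; exists (mkposreal 1 Rlt_0_1); intros s t _ _.
  replace (s - t - (x - y) - (1 * (s - x) + -1 * (t - y)))%R with 0%R by ring.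
  rewrite Rabs_R0; apply Rmult_le_pos; [apply Rlt_le, cond_pos|].
  eapply Rle_trans; [apply Rabs_pos | apply Rmax_l].
Qed.

Lemma differentiable_mult (x y : R) : differentiable_pt_lim Rmult x y y x.
Proof.
  (* The remainder is exactly [(s - x) * (t - y)]: one factor is below [eps], the other below the
     maximum. *)
  intros eps; exists eps; intros s t Hs _.
  replace (s * t - x * y - (y * (s - x) + x * (t - y)))%R
    with ((s - x) * (t - y))%R by ring.
  rewrite Rabs_mult; apply Rmult_le_compat; try apply Rabs_pos.
  - now apply Rlt_le.
  - apply Rmax_r.
Qed.

Lemma is_pd_comp (h : R -> R -> R) (f g : C -> R) (z : C)
    (a b f1 f2 g1 g2 : R) :
  differentiable_pt_lim h (f z) (g z) a b ->
  is_pd f z f1 f2 -> is_pd g z g1 g2 ->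
  is_pd (fun w => h (f w) (g w)) z (a * f1 + b * g1) (a * f2 + b * g2).
Proof.
  intros Hh Hf Hg; unfold is_pd.
  apply (differentiable_pt_lim_comp h (fun x y => f (x, y))
           (fun x y => g (x, y))); try assumption.
  now destruct z.
Qed.

Lemma is_pd_eq (f : C -> R) (z : C) (a b a' b' : R) :
  is_pd f z a b -> a = a' -> b = b' -> is_pd f z a' b'.
Proof. now intros H <- <-. Qed.

Lemma is_wd_eq (f : C -> C) (z p q p' q' : C) :
  is_wd f z p q -> p = p' -> q = q' -> is_wd f z p' q'.
Proof. now intros H <- <-. Qed.

Lemma is_wd_ext_loc (f g : C -> C) (z p q : C) :
  locally z (fun w => f w = g w) -> is_wd f z p q -> is_wd g z p q.
Proof.
  intros H [H1 H2]; split; eapply is_pd_ext_loc; eauto;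
    revert H; apply filter_imp; now intros w ->.
Qed.

Lemma is_wd_ext (f g : C -> C) (z p q : C) :
  (forall w, f w = g w) -> is_wd f z p q -> is_wd g z p q.
Proof. intros H; apply is_wd_ext_loc; now apply filter_forall. Qed.

Lemma is_wd_unique (f : C -> C) (z p q : C) :
  is_wd f z p q -> dzeta f z = p /\ dzetabar f z = q.
Proof.
  intros [H1 H2]; apply is_pd_unique in H1; apply is_pd_unique in H2.
  destruct H1 as [H1 H1'], H2 as [H2 H2'].
  unfold dzeta, dzetabar, Cdxi, Cdeta; rewrite H1, H1', H2, H2'.
  split; apply C_ext; parts.
Qed.

(** Any explicit pair of derivatives certifies differentiability; uniqueness then lets [dzeta] and
    [dzetabar] replace the pair. *)
Lemma is_wd_correct (f : C -> C) (z p q : C) :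
  is_wd f z p q -> is_wd f z (dzeta f z) (dzetabar f z).
Proof. intros H; now destruct (is_wd_unique _ _ _ _ H) as [-> ->]. Qed.

Lemma is_wd_of_pd (f : C -> C) (z : C) (a b c d : R) :
  is_pd (fun w => Re (f w)) z a b -> is_pd (fun w => Im (f w)) z c d ->
  is_wd f z (/ 2 * ((a, c) - Ci * (b, d))) (/ 2 * ((a, c) + Ci * (b, d))).
Proof.
  intros H1 H2; split; [eapply is_pd_eq; [exact H1|..]
                       |eapply is_pd_eq; [exact H2|..]]; parts.
Qed.

(** * Rules of the Wirtinger calculus *)

Lemma is_wd_const (c z : C) : is_wd (fun _ => c) z 0 0.
Proof.
  assert (H : forall k, is_pd (fun _ => k) z 0 0)
    by (intros k; apply (differentiable_pt_lim_proj1_0 (fun _ => k)),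
        derivable_pt_lim_const).
  split; (eapply is_pd_eq; [apply H|..]); parts.
Qed.

(** Substitute [k = p h + q (conj h)] into [a k + b (conj k)] and collect the coefficients of [h]
    and [conj h]. *)
Lemma is_wd_comp (g f : C -> C) (z a b p q : C) :
  is_wd g (f z) a b -> is_wd f z p q ->
  is_wd (fun w => g (f w)) z (a * p + b * Cconj q) (a * q + b * Cconj p).
Proof.
  intros [Hg1 Hg2] [Hf1 Hf2].
  pose proof (is_pd_comp (fun x y => Re (g (x, y)))
    (fun w => Re (f w)) (fun w => Im (f w)) _ _ _ _ _ _ _ Hg1 Hf1 Hf2) as H1.
  pose proof (is_pd_comp (fun x y => Im (g (x, y)))
    (fun w => Re (f w)) (fun w => Im (f w)) _ _ _ _ _ _ _ Hg2 Hf1 Hf2) as H2.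
  apply (is_wd_ext (fun w => g (Re (f w), Im (f w)))).
  { intros w; now destruct (f w). }
  split; [eapply is_pd_eq; [exact H1|..]|eapply is_pd_eq; [exact H2|..]];
    parts.
Qed.

Lemma is_wd_Cconj (w : C) : is_wd Cconj w 0 1.
Proof.
  split.
  - eapply is_pd_eq; [exact (differentiable_fst _ _)|..]; parts.
  - eapply is_pd_eq; [exact (differentiable_snd _ _ _ _
      (derivable_pt_lim_opp _ _ _ (derivable_pt_lim_id _)))|..]; parts.
Qed.

Lemma is_wd_Cbar (f : C -> C) (z p q : C) :
  is_wd f z p q -> is_wd (Cbar f) z (Cconj q) (Cconj p).
Proof.
  intros H; eapply is_wd_eq;
    [apply (is_wd_comp Cconj f _ _ _ _ _ (is_wd_Cconj _) H)|..]; ring.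
Qed.

(** The vanishing second derivative expresses that the exponential is holomorphic. *)
Lemma is_wd_Cexp (w : C) : is_wd Cexp w (Cexp w) 0.
Proof.
  assert (He : is_pd (fun w => exp (Re w)) w (exp (Re w)) 0)
    by apply (differentiable_pt_lim_proj1_0 exp), derivable_pt_lim_exp.
  split.
  - eapply is_pd_eq; [eapply (is_pd_comp Rmult _ (fun w => cos (Im w)));
      [apply differentiable_mult | exact He | apply (differentiable_snd cos),
         derivable_pt_lim_cos] |..]; unfold Cexp; parts.
  - eapply is_pd_eq; [eapply (is_pd_comp Rmult _ (fun w => sin (Im w)));
      [apply differentiable_mult | exact He | apply (differentiable_snd sin),
         derivable_pt_lim_sin] |..]; unfold Cexp; parts.
Qed.

Lemma is_wd_plus (f g : C -> C) (z p q p' q' : C) :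
  is_wd f z p q -> is_wd g z p' q' ->
  is_wd (fun w => f w + g w) z (p + p') (q + q').
Proof.
  intros [Hf1 Hf2] [Hg1 Hg2]; split.
  - eapply is_pd_eq; [exact (is_pd_comp Rplus _ _ _ _ _ _ _ _ _
      (differentiable_plus _ _) Hf1 Hg1)|..]; parts.
  - eapply is_pd_eq; [exact (is_pd_comp Rplus _ _ _ _ _ _ _ _ _
      (differentiable_plus _ _) Hf2 Hg2)|..]; parts.
Qed.

Lemma is_wd_mult (f g : C -> C) (z p q p' q' : C) :
  is_wd f z p q -> is_wd g z p' q' ->
  is_wd (fun w => f w * g w) z (p * g z + f z * p') (q * g z + f z * q').
Proof.
  intros [Hf1 Hf2] [Hg1 Hg2].
  assert (Hm : forall a b a1 a2 b1 b2, is_pd a z a1 a2 -> is_pd b z b1 b2 ->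
    is_pd (fun w => a w * b w)%R z (b z * a1 + a z * b1) (b z * a2 + a z * b2))
    by (intros; apply is_pd_comp; auto using differentiable_mult).
  split.
  - eapply is_pd_eq; [exact (is_pd_comp Rminus _ _ _ _ _ _ _ _ _
      (differentiable_minus _ _) (Hm _ _ _ _ _ _ Hf1 Hg1)
      (Hm _ _ _ _ _ _ Hf2 Hg2))|..]; parts.
  - eapply is_pd_eq; [exact (is_pd_comp Rplus _ _ _ _ _ _ _ _ _
      (differentiable_plus _ _) (Hm _ _ _ _ _ _ Hf1 Hg2)
      (Hm _ _ _ _ _ _ Hf2 Hg1))|..]; parts.
Qed.

(** * Smooth functions on an open set *)

Lemma smooth_dxi (D : C -> Prop) (g : C -> R) :
  smooth_on D g -> smooth_on D (dxi g).
Proof.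
  intros H z Dz n; exact (ex_diff_n_deriv_aux1 _ _ _ _ (H z Dz (S n))).
Qed.

Lemma smooth_deta (D : C -> Prop) (g : C -> R) :
  smooth_on D g -> smooth_on D (deta g).
Proof.
  intros H z Dz n; exact (ex_diff_n_deriv_aux2 _ _ _ _ (H z Dz (S n))).
Qed.

Lemma smooth_const (D : C -> Prop) (c : R) : smooth_on D (fun _ => c).
Proof.
  (* The constant must vary in the induction, since the partial derivatives of [c] are the constant
     0. *)
  intros z _ n; generalize (Re z) (Im z); intros x y; revert c x y.
  induction n as [|n IH]; intros c x y; simpl.
  - split; [apply continuity_2d_pt_const | exact I].
  - repeat split; try apply ex_derive_const.
    + apply continuity_2d_pt_const.
    + apply (ex_diff_n_ext_loc (fun _ _ => 0%R)); [|apply IH].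
      apply locally_2d_forall; intros; symmetry; apply Derive_const.
    + apply (ex_diff_n_ext_loc (fun _ _ => 0%R)); [|apply IH].
      apply locally_2d_forall; intros; symmetry; apply Derive_const.
Qed.

Lemma locally_2d_open (D : C -> Prop) (P : R -> R -> Prop) (z : C) :
  open D -> D z -> (forall w, D w -> P (Re w) (Im w)) ->
  locally_2d P (Re z) (Im z).
Proof.
  intros HD Dz HP; apply locally_2d_locally.
  generalize (HD z Dz); destruct z as [x y].
  apply filter_imp; intros w Dw; now apply HP.
Qed.

(** It suffices that the [xi]-derivative exists near [z] and is continuous at [z], and that the
    [eta]-derivative exists at [z]. *)
Lemma smooth_is_pd (D : C -> Prop) (g : C -> R) (z : C) :
  open D -> smooth_on D g -> D z -> is_pd g z (dxi g z) (deta g z).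
Proof.
  intros HD Hg Dz; apply filterdiff_differentiable_pt_lim.
  apply (is_derive_filterdiff (fun x y => g (x, y)) _ _
           (fun x y => dxi g (x, y)) (deta g z)).
  - generalize (HD z Dz); destruct z as [x y]; apply filter_imp.
    intros w Dw; apply Derive_correct, (Hg w Dw 1%nat).
  - apply Derive_correct, (Hg z Dz 1%nat).
  - apply (continuity_2d_pt_filterlim (fun x y => dxi g (x, y))).
    exact (proj1 (smooth_dxi _ _ Hg z Dz 0%nat)).
Qed.

Lemma smooth_schwarz (D : C -> Prop) (g : C -> R) (z : C) :
  open D -> smooth_on D g -> D z -> dxi (deta g) z = deta (dxi g) z.
Proof.
  intros HD Hg Dz.
  apply (Schwarz (fun x y => g (x, y)) (Re z) (Im z)).
  - apply (locally_2d_open D); auto.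
    intros w Dw; repeat split.
    + apply (Hg w Dw 1%nat).
    + apply (Hg w Dw 1%nat).
    + apply (smooth_deta _ _ Hg w Dw 1%nat).
    + apply (smooth_dxi _ _ Hg w Dw 1%nat).
  - exact (proj1 (smooth_dxi _ _ (smooth_deta _ _ Hg) z Dz 0%nat)).
  - exact (proj1 (smooth_deta _ _ (smooth_dxi _ _ Hg) z Dz 0%nat)).
Qed.

Lemma Csmooth_is_wd (D : C -> Prop) (f : C -> C) (z : C) :
  open D -> Csmooth_on D f -> D z -> is_wd f z (dzeta f z) (dzetabar f z).
Proof.
  intros HD [H1 H2] Dz.
  eapply is_wd_correct, is_wd_of_pd; eapply smooth_is_pd; eauto.
Qed.

Lemma Csmooth_Cdxi (D : C -> Prop) (f : C -> C) :
  Csmooth_on D f -> Csmooth_on D (Cdxi f).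
Proof. intros [H1 H2]; split; now apply smooth_dxi. Qed.

Lemma Csmooth_Cdeta (D : C -> Prop) (f : C -> C) :
  Csmooth_on D f -> Csmooth_on D (Cdeta f).
Proof. intros [H1 H2]; split; now apply smooth_deta. Qed.

Lemma Csmooth_Cfun (D : C -> Prop) (g : C -> R) :
  smooth_on D g -> Csmooth_on D (Cfun g).
Proof. intros H; split; [exact H | apply (smooth_const D 0)]. Qed.

Lemma is_wd_scal (c : C) (f : C -> C) (z p q : C) :
  is_wd f z p q -> is_wd (fun w => c * f w) z (c * p) (c * q).
Proof.
  intros H; eapply is_wd_eq;
    [exact (is_wd_mult _ _ _ _ _ _ _ (is_wd_const c z) H)|..]; cbv beta; ring.
Qed.

(** * Second Wirtinger derivatives and their symmetry *)

Section SecondOrder.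

Variables (D : C -> Prop) (f : C -> C) (z : C).
Hypotheses (HD : open D) (Hf : Csmooth_on D f) (Dz : D z).

(** Both [dzeta f] and [dzetabar f] are such combinations with constant coefficients. *)
Lemma is_wd_first_order (a b : C) :
  is_wd (fun w => a * Cdxi f w + b * Cdeta f w) z
    (a * dzeta (Cdxi f) z + b * dzeta (Cdeta f) z)
    (a * dzetabar (Cdxi f) z + b * dzetabar (Cdeta f) z).
Proof.
  apply is_wd_plus; apply is_wd_scal; apply (Csmooth_is_wd D);
    auto using Csmooth_Cdxi, Csmooth_Cdeta.
Qed.

Lemma is_wd_dzeta_explicit :
  is_wd (dzeta f) z
    (/ 2 * dzeta (Cdxi f) z + - (/ 2 * Ci) * dzeta (Cdeta f) z)
    (/ 2 * dzetabar (Cdxi f) z + - (/ 2 * Ci) * dzetabar (Cdeta f) z).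
Proof.
  eapply is_wd_ext; [|apply is_wd_first_order].
  intros w; unfold dzeta; ring.
Qed.

Lemma is_wd_dzetabar_explicit :
  is_wd (dzetabar f) z
    (/ 2 * dzeta (Cdxi f) z + / 2 * Ci * dzeta (Cdeta f) z)
    (/ 2 * dzetabar (Cdxi f) z + / 2 * Ci * dzetabar (Cdeta f) z).
Proof.
  eapply is_wd_ext; [|apply is_wd_first_order].
  intros w; unfold dzetabar; ring.
Qed.

Lemma is_wd_dzeta :
  is_wd (dzeta f) z (dzeta (dzeta f) z) (dzetabar (dzeta f) z).
Proof. eapply is_wd_correct, is_wd_dzeta_explicit. Qed.

(** Once expanded, the two sides differ only in the order of the mixed partial derivatives. *)
Lemma dzeta_dzetabar : dzeta (dzetabar f) z = dzetabar (dzeta f) z.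
Proof.
  destruct (is_wd_unique _ _ _ _ is_wd_dzeta_explicit) as [_ ->].
  destruct (is_wd_unique _ _ _ _ is_wd_dzetabar_explicit) as [-> _].
  assert (E : Cdxi (Cdeta f) z = Cdeta (Cdxi f) z).
  { destruct Hf; apply C_ext; now apply (smooth_schwarz D). }
  unfold dzeta, dzetabar; rewrite E; ring.
Qed.

Lemma is_wd_dzetabar :
  is_wd (dzetabar f) z (dzetabar (dzeta f) z) (dzetabar (dzetabar f) z).
Proof.
  rewrite <- dzeta_dzetabar; eapply is_wd_correct, is_wd_dzetabar_explicit.
Qed.

End SecondOrder.

(** * Real-valued functions: conjugation exchanges the two Wirtinger derivatives *)

Lemma Cdxi_Cfun (g : C -> R) (z : C) : Cdxi (Cfun g) z = RtoC (dxi g z).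
Proof. apply C_ext; [reflexivity | exact (Derive_const 0 (Re z))]. Qed.

Lemma Cdeta_Cfun (g : C -> R) (z : C) : Cdeta (Cfun g) z = RtoC (deta g z).
Proof. apply C_ext; [reflexivity | exact (Derive_const 0 (Im z))]. Qed.

Lemma Cbar_dzeta_Cfun (g : C -> R) (z : C) :
  Cbar (dzeta (Cfun g)) z = dzetabar (Cfun g) z.
Proof.
  unfold Cbar, dzeta, dzetabar; rewrite Cdxi_Cfun, Cdeta_Cfun.
  apply C_ext; parts.
Qed.

Lemma is_wd_dzetabar_Cfun (D : C -> Prop) (g : C -> R) (z : C) :
  open D -> smooth_on D g -> D z ->
  is_wd (dzetabar (Cfun g)) z (Cconj (dzetabar (dzeta (Cfun g)) z))
    (Cconj (dzeta (dzeta (Cfun g)) z)).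
Proof.
  intros HD Hg Dz; eapply is_wd_ext; [apply Cbar_dzeta_Cfun|].
  apply is_wd_Cbar, (is_wd_dzeta D); auto using Csmooth_Cfun.
Qed.

(** The derivative [dzeta (dzetabar g)] is computed twice, once by conjugating [dzeta g] and once by
    symmetry of second derivatives. *)
Lemma laplacian_real (D : C -> Prop) (g : C -> R) (z : C) :
  open D -> smooth_on D g -> D z ->
  Cconj (dzetabar (dzeta (Cfun g)) z) = dzetabar (dzeta (Cfun g)) z.
Proof.
  intros HD Hg Dz.
  destruct (is_wd_unique _ _ _ _ (is_wd_dzetabar_Cfun D g z HD Hg Dz))
    as [<- _].
  apply (dzeta_dzetabar D); auto using Csmooth_Cfun.
Qed.

(** * The complex exponential *)

Lemma Cexp_plus (a b : C) : Cexp (a + b) = Cexp a * Cexp b.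
Proof.
  apply C_ext; unfold Cexp, Re, Im; simpl;
    rewrite exp_plus, ?cos_plus, ?sin_plus; ring.
Qed.

Lemma Cexp_RtoC (x : R) : Cexp x = exp x.
Proof. apply C_ext; simpl; rewrite ?cos_0, ?sin_0; ring. Qed.

Lemma Cexp_conj (a : C) : Cexp (Cconj a) = Cconj (Cexp a).
Proof. apply C_ext; simpl; rewrite ?cos_neg, ?sin_neg; unfold Re, Im; ring. Qed.

Lemma Cexp_0 : Cexp 0 = 1.
Proof. now rewrite Cexp_RtoC, exp_0. Qed.

Lemma Cexp_neq_0 (a : C) : Cexp a <> 0.
Proof.
  intros H; apply C1_nz; rewrite <- Cexp_0.
  replace (RtoC 0) with (a + - a) by ring.
  rewrite Cexp_plus, H; ring.
Qed.

(** * Derivatives of the harmonic map in terms of [omega] and [theta] *)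

Section HarmonicDiffeomorphism.

Variables (M N : C -> Prop) (F : C -> R) (u : C -> C) (omega theta : C -> R).
Hypotheses (HM : open M) (HN : open N) (HF : smooth_on N F)
  (Hu : Csmooth_on M u) (HuN : forall z, M z -> N (u z))
  (Hharm : harmonic_map M F u) (Hspec : specific_coordinate M F u)
  (Homega : smooth_on M omega) (Htheta : smooth_on M theta)
  (Hv : forall z, M z ->
     Cexp (omega z + Ci * theta z) = exp (F (u z) / 2) * dzeta u z).

Let v (z : C) : C := Cfun omega z + Ci * Cfun theta z.

Lemma is_wd_u (z : C) : M z -> is_wd u z (dzeta u z) (dzetabar u z).
Proof. intros Mz; now apply (Csmooth_is_wd M). Qed.

Lemma dzeta_Cbar_u (z : C) :
  M z -> dzeta (Cbar u) z = Cconj (dzetabar u z).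
Proof.
  intros Mz; apply (is_wd_unique _ _ _ _ (is_wd_Cbar _ _ _ _ (is_wd_u z Mz))).
Qed.

Lemma dzeta_u_exp (z : C) :
  M z -> dzeta u z = exp (- F (u z) / 2) * Cexp (v z).
Proof.
  intros Mz; unfold v, Cfun; rewrite (Hv z Mz), Cmult_assoc, <- RtoC_mult,
    <- exp_plus.
  replace (- F (u z) / 2 + F (u z) / 2)%R with 0%R by field.
  rewrite exp_0; ring.
Qed.

(** The specific coordinate gives [conj q = e^(-F/2) e^(-v)]. Conjugate and use
    [- conj v = v - 2 omega]. *)
Lemma dzetabar_u_exp (z : C) :
  M z -> dzetabar u z = exp (- (2 * omega z)) * dzeta u z.
Proof.
  intros Mz.
  assert (H := Hspec z Mz).
  assert (Hq : Cconj (dzetabar u z) = exp (- F (u z) / 2) * Cexp (- v z)).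
  { assert (E : RtoC (exp (F (u z))) * dzeta u z
                * (exp (- F (u z) / 2) * Cexp (- v z)) = 1).
    { rewrite (dzeta_u_exp z Mz), <- !Cexp_RtoC, !Cmult_assoc, <- !Cexp_plus,
        <- Cexp_0; f_equal.
      rewrite <- !RtoC_plus.
      apply C_ext; parts. }
    rewrite (dzeta_Cbar_u z Mz) in H.
    assert (Hne : RtoC (exp (F (u z))) * dzeta u z <> 0).
    { intros H0; rewrite H0, Cmult_0_l in H; now apply C1_nz. }
    (* Both candidates for [conj q] are inverse to the same nonzero factor. *)
    transitivity (/ (exp (F (u z)) * dzeta u z) * 1); [rewrite <- H|rewrite <- E];
      field; split; intros H0; apply Hne; rewrite H0; ring. }
  rewrite <- (Cconj_conj (dzetabar u z)), Hq, (dzeta_u_exp z Mz).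
  rewrite Cmult_conj, <- Cexp_conj, <- !Cexp_RtoC, <- Cexp_conj, <- !Cexp_plus.
  f_equal; apply C_ext; unfold v, Cfun; parts.
Qed.

Lemma is_wd_v (z : C) : M z ->
  is_wd v z (dzeta (Cfun omega) z + Ci * dzeta (Cfun theta) z)
    (dzetabar (Cfun omega) z + Ci * dzetabar (Cfun theta) z).
Proof.
  intros Mz; apply is_wd_plus; [|apply is_wd_scal];
    apply (Csmooth_is_wd M); auto using Csmooth_Cfun.
Qed.

Lemma is_wd_F_u (w : C) : N w -> is_wd (F_u F) w (F_uu F w) (F_uub F w).
Proof. intros Nw; apply (is_wd_dzeta N); auto using Csmooth_Cfun. Qed.

Lemma is_wd_F_ub (w : C) : N w -> is_wd (F_ub F) w (F_uub F w) (F_ubub F w).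
Proof. intros Nw; apply (is_wd_dzetabar N); auto using Csmooth_Cfun. Qed.

Lemma Cconj_F_u (w : C) : Cconj (F_u F w) = F_ub F w.
Proof. apply Cbar_dzeta_Cfun. Qed.

Lemma Cconj_F_ub (w : C) : Cconj (F_ub F w) = F_u F w.
Proof. now rewrite <- Cconj_F_u, Cconj_conj. Qed.

Lemma Cconj_F_uub (w : C) : N w -> Cconj (F_uub F w) = F_uub F w.
Proof. now apply (laplacian_real N). Qed.

Lemma Cconj_F_uu (w : C) : N w -> Cconj (F_uu F w) = F_ubub F w.
Proof.
  intros Nw; symmetry.
  apply (is_wd_unique _ _ _ _ (is_wd_dzetabar_Cfun N F w HN HF Nw)).
Qed.

Lemma harmonic_eq (z : C) : M z ->
  dzetabar (dzeta u) z = - (F_u F (u z) * dzeta u z * dzetabar u z).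
Proof.
  intros Mz; assert (H := Hharm z Mz).
  transitivity (dzetabar (dzeta u) z + F_u F (u z) * dzeta u z * dzetabar u z
    - F_u F (u z) * dzeta u z * dzetabar u z); [ring | rewrite H; ring].
Qed.

(** Through [v] the derivative of [e^v] is [e^v v_zetabar]. The product rule for [e^(F/2) p] gives
    [e^v (F_u q + F_ub (conj p)) / 2], plus [- e^v F_u q] by harmonicity. Then [e^v] cancels. *)
Lemma dzetabar_v (z : C) : M z ->
  dzetabar (Cfun omega) z + Ci * dzetabar (Cfun theta) z
  = / 2 * (F_ub F (u z) * Cconj (dzeta u z) - F_u F (u z) * dzetabar u z).
Proof.
  intros Mz.
  assert (H1 := is_wd_comp _ _ _ _ _ _ _ (is_wd_Cexp (v z)) (is_wd_v z Mz)).
  assert (HFu := is_wd_comp _ _ _ _ _ _ _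
    (Csmooth_is_wd N _ _ HN (Csmooth_Cfun _ _ HF) (HuN z Mz)) (is_wd_u z Mz)).
  assert (H2 := is_wd_mult _ _ _ _ _ _ _
    (is_wd_comp Cexp (fun w => / 2 * Cfun F (u w)) _ _ _ _ _ (is_wd_Cexp _)
       (is_wd_scal (/ 2) _ _ _ _ HFu))
    (is_wd_dzeta M u z HM Hu Mz)).
  assert (Hhalf : forall x : R, RtoC (exp (x / 2)) = Cexp (/ 2 * x)).
  { intros x; rewrite <- Cexp_RtoC; f_equal; apply C_ext; parts. }
  apply (is_wd_ext_loc _ (fun w => Cexp (v w))) in H2.
  (* The relation for [e^v] is known only on [M]; openness makes it hold near [z], so it may be
     differentiated. *)
  2: { generalize (HM z Mz); apply filter_imp; intros w Mw.
       unfold v, Cfun; now rewrite (Hv w Mw), Hhalf. }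
  apply is_wd_unique in H1; apply is_wd_unique in H2.
  destruct H1 as [_ H1], H2 as [_ H2]; rewrite H2 in H1; clear H2.
  assert (E : Cexp (v z) = Cexp (/ 2 * Cfun F (u z)) * dzeta u z).
  { unfold v, Cfun; now rewrite (Hv z Mz), Hhalf. }
  rewrite (harmonic_eq z Mz) in H1.
  assert (Hne : Cexp (v z) <> 0) by apply Cexp_neq_0.
  transitivity (/ Cexp (v z) * (Cexp (v z) *
    (dzetabar (Cfun omega) z + Ci * dzetabar (Cfun theta) z))).
  { field; exact Hne. }
  transitivity (/ Cexp (v z) * (Cexp (v z) *
     (/ 2 * (F_ub F (u z) * Cconj (dzeta u z) - F_u F (u z) * dzetabar u z)))).
  2: { field; exact Hne. }
  f_equal.
  match type of H1 with _ = ?r => transitivity r end; [ring|].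
  rewrite <- H1, E; unfold F_ub, F_u; field.
Qed.

(** In the [zeta]-derivative of [dzetabar_v], harmonicity gives [q_zeta = - F_u p q] and, by
    conjugation, [(conj p)_zeta = - F_ub (conj (p q))]. These produce the squares of [F_u] and
    [F_ub]. *)
Lemma dzeta_dzetabar_v (z : C) : M z ->
  dzetabar (dzeta (Cfun omega)) z + Ci * dzetabar (dzeta (Cfun theta)) z
  = / 2 * (F_uub F (u z) *
             (dzeta u z * Cconj (dzeta u z)
              - dzetabar u z * Cconj (dzetabar u z))
           + (F_ubub F (u z) - F_ub F (u z) ^ 2)
             * Cconj (dzeta u z * dzetabar u z)
           - (F_uu F (u z) - F_u F (u z) ^ 2) * (dzeta u z * dzetabar u z)).
Proof.
  intros Mz; assert (Nz := HuN z Mz).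
  assert (H1 := is_wd_plus _ _ _ _ _ _ _
    (is_wd_dzetabar M (Cfun omega) z HM (Csmooth_Cfun _ _ Homega) Mz)
    (is_wd_scal Ci _ _ _ _
      (is_wd_dzetabar M (Cfun theta) z HM (Csmooth_Cfun _ _ Htheta) Mz))).
  assert (Hf1 := is_wd_mult _ _ _ _ _ _ _
    (is_wd_comp _ _ _ _ _ _ _ (is_wd_F_ub _ Nz) (is_wd_u z Mz))
    (is_wd_Cbar _ _ _ _ (is_wd_dzeta M u z HM Hu Mz))).
  assert (Hf2 := is_wd_scal (-1) _ _ _ _ (is_wd_mult _ _ _ _ _ _ _
    (is_wd_comp _ _ _ _ _ _ _ (is_wd_F_u _ Nz) (is_wd_u z Mz))
    (is_wd_dzetabar M u z HM Hu Mz))).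
  assert (H2 := is_wd_scal (/ 2) _ _ _ _ (is_wd_plus _ _ _ _ _ _ _ Hf1 Hf2)).
  clear Hf1 Hf2.
  apply (is_wd_ext_loc _ (fun w => dzetabar (Cfun omega) w
                                   + Ci * dzetabar (Cfun theta) w)) in H2.
  2: { generalize (HM z Mz); apply filter_imp; intros w Mw.
       rewrite (dzetabar_v w Mw); unfold Cbar; ring. }
  apply is_wd_unique in H1; apply is_wd_unique in H2.
  destruct H1 as [H1 _], H2 as [H2 _]; rewrite H2 in H1; rewrite <- H1.
  rewrite (harmonic_eq z Mz), Copp_conj, !Cmult_conj, Cconj_F_u; unfold Cbar.
  cbv beta; ring.
Qed.

Lemma dzeta_u_Cconj_dzeta_u (z : C) : M z ->
  dzeta u z * Cconj (dzeta u z) = exp (- F (u z)) * exp (2 * omega z).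
Proof.
  intros Mz; rewrite (dzeta_u_exp z Mz), <- !Cexp_RtoC, Cmult_conj,
    <- !Cexp_conj, <- !Cexp_plus.
  f_equal; apply C_ext; unfold v, Cfun; parts.
Qed.

(** This is the Jacobian of [u]. Since [|q|^2 = e^(-4 omega) |p|^2], it equals
    [e^(-F) (e^(2 omega) - e^(-2 omega))]. *)
Lemma jacobian_factor (z : C) : M z ->
  dzeta u z * Cconj (dzeta u z) - dzetabar u z * Cconj (dzetabar u z)
  = 2 * exp (- F (u z)) * sinh (2 * omega z).
Proof.
  intros Mz; rewrite (dzetabar_u_exp z Mz), Cmult_conj.
  transitivity ((1 - exp (- (2 * omega z)) * Cconj (exp (- (2 * omega z)))) *
                (dzeta u z * Cconj (dzeta u z))); [ring|].
  rewrite (dzeta_u_Cconj_dzeta_u z Mz).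
  assert (E : (exp (- (2 * omega z)) * exp (2 * omega z) = 1)%R)
    by (rewrite <- exp_plus, Rplus_opp_l; apply exp_0).
  unfold sinh.
  set (a := exp (- (2 * omega z))) in *; set (b := exp (2 * omega z)) in *.
  apply C_ext; unfold Re, Im; simpl; [|field].
  transitivity (exp (- F (u z)) * (b - a * (a * b)))%R; [ring|].
  rewrite E; field.
Qed.

(** In [p q = e^(-2 omega) p^2] the factor [e^(-2 omega)] cancels the modulus of [e^(2 v)], leaving
    only its phase. *)
Lemma dzeta_mult_dzetabar_u (z : C) : M z ->
  dzeta u z * dzetabar u z = exp (- F (u z)) * Cexp (2 * Ci * theta z).
Proof.
  intros Mz; rewrite (dzetabar_u_exp z Mz), (dzeta_u_exp z Mz), <- !Cexp_RtoC,
    <- !Cexp_plus.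
  f_equal; apply C_ext; unfold v, Cfun; parts.
Qed.

(** * Separation into the two second order equations *)

Lemma real_imaginary_split (z : C) (P T : C) : M z ->
  Cconj P = P -> Cconj T = - T ->
  dzetabar (dzeta (Cfun omega)) z + Ci * dzetabar (dzeta (Cfun theta)) z
    = P + T ->
  dzetabar (dzeta (Cfun omega)) z = P /\
  Ci * dzetabar (dzeta (Cfun theta)) z = T.
Proof.
  intros Mz HP HT H.
  assert (H1 := laplacian_real M omega z HM Homega Mz).
  assert (H2 := laplacian_real M theta z HM Htheta Mz).
  revert H1 H2 H; generalize (dzetabar (dzeta (Cfun omega)) z)
    (dzetabar (dzeta (Cfun theta)) z); intros A B H1 H2 H.
  apply (f_equal Im) in H1, H2, HP; apply (f_equal Re) in HT.
  assert (Hr := f_equal Re H); assert (Hi := f_equal Im H).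
  destruct A as [a a'], B as [b b'], P as [p p'], T as [t t'].
  simpl in *; split; apply C_ext; simpl; lra.
Qed.

Lemma second_order (z : C) : M z ->
  dzetabar (dzeta (Cfun omega)) z
    = F_uub F (u z) * (exp (- F (u z)) * sinh (2 * omega z)) /\
  Ci * dzetabar (dzeta (Cfun theta)) z
    = / 2 * (exp (- F (u z)) *
      ((F_u F (u z) ^ 2 - F_uu F (u z)) * Cexp (2 * Ci * theta z)
       - (F_ub F (u z) ^ 2 - F_ubub F (u z)) * Cexp (- (2 * Ci * theta z)))).
Proof.
  intros Mz; assert (Nz := HuN z Mz).
  assert (Hc : Cconj (Cexp (2 * Ci * theta z)) = Cexp (- (2 * Ci * theta z))).
  { rewrite <- Cexp_conj; f_equal; apply C_ext; parts. }
  assert (Hr : forall x : R, Cconj x = x) by (intros x; apply C_ext; parts).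
  assert (Hub : Cconj (F_ubub F (u z)) = F_uu F (u z))
    by now rewrite <- Cconj_F_uu, Cconj_conj.
  apply real_imaginary_split; auto.
  - now rewrite !Cmult_conj, !Hr, Cconj_F_uub.
  (* This term is a real multiple of [A - conj A] with [A = (F_u^2 - F_uu) e^(2 i theta)], so
     conjugation changes its sign. *)
  - rewrite !Cmult_conj, Cminus_conj, !Cmult_conj, !Cminus_conj, !Cpow_conj,
      <- Hc, Cconj_conj, Hr, Cconj_F_u, Cconj_F_ub, Hub, Cconj_F_uu by auto.
    rewrite <- RtoC_inv, Hr by lra. ring.
  - rewrite (dzeta_dzetabar_v z Mz), (jacobian_factor z Mz),
      (dzeta_mult_dzetabar_u z Mz), Cmult_conj, Hr, Hc; field.
Qed.

(** * Nonvanishing of [omega] and the first order system *)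

(** Differentiating [g (u w) = w] gives [a p + b (conj q) = 1] and [a q + b (conj p) = 0]. At a zero
    of [omega] one has [q = p], so the two left sides agree and [1 = 0]. *)
Lemma omega_neq_0 (g : C -> C) (z : C) :
  Csmooth_on N g -> (forall w, M w -> g (u w) = w) -> M z -> omega z <> 0%R.
Proof.
  intros Hg Hgu Mz H0.
  assert (H1 := is_wd_comp _ _ _ _ _ _ _
    (Csmooth_is_wd N g (u z) HN Hg (HuN z Mz)) (is_wd_u z Mz)).
  apply (is_wd_ext_loc _ (fun w => w)) in H1.
  2: { generalize (HM z Mz); now apply filter_imp. }
  assert (H2 : is_wd (fun w => w) z 1 0).
  { split.
    - eapply is_pd_eq; [exact (differentiable_fst _ _)|..]; parts.
    - eapply is_pd_eq; [exact (differentiable_snd _ _ _ _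
        (derivable_pt_lim_id _))|..]; parts. }
  apply is_wd_unique in H1; apply is_wd_unique in H2.
  destruct H1 as [H1 H1'], H2 as [H2 H2'].
  rewrite H2 in H1; rewrite H2' in H1'.
  rewrite (dzetabar_u_exp z Mz), H0, Rmult_0_r, Ropp_0, exp_0, Cmult_1_l
    in H1, H1'.
  apply C1_nz; rewrite H1, H1'; reflexivity.
Qed.

(** With [k = e^(-2 omega)] and [G = F_u p], everything is explicit: [2 v_zetabar = conj G - k G],
    [F_xi = 2 (1 + k) Re G], [F_eta = - 2 (1 - k) Im G] and [tanh omega = (1 - k) / (1 + k)]. *)
Lemma first_order (z : C) : M z -> omega z <> 0%R ->
  RtoC (dxi omega z - deta theta z) = / 2 * tanh (omega z) * F_xi F u z /\
  RtoC (deta omega z + dxi theta z) = / 2 * coth (omega z) * F_eta F u z.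
Proof.
  intros Mz H0; assert (H := dzetabar_v z Mz).
  set (k := exp (- (2 * omega z))).
  set (G := F_u F (u z) * dzeta u z).
  (* This is where [omega z <> 0] enters: it makes the denominator of [coth] nonzero. *)
  assert (Hk : (k <> 1)%R).
  { unfold k; rewrite <- exp_0; intros E; apply exp_inv in E; lra. }
  assert (Hk' : (0 < k)%R) by apply exp_pos.
  assert (HGb : Cconj G = F_ub F (u z) * Cconj (dzeta u z))
    by (unfold G; now rewrite Cmult_conj, Cconj_F_u).
  assert (Hxi : Cdxi u z = dzeta u z + dzetabar u z)
    by (unfold dzeta, dzetabar; field).
  assert (Heta : Cdeta u z = Ci * (dzeta u z - dzetabar u z)).
  { apply C_ext; unfold dzeta, dzetabar; parts. }
  assert (Hcx : Cdxi (Cbar u) z = Cconj (Cdxi u z)).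
  { apply C_ext; [reflexivity|]; exact (Derive_opp _ _). }
  assert (Hce : Cdeta (Cbar u) z = Cconj (Cdeta u z)).
  { apply C_ext; [reflexivity|]; exact (Derive_opp _ _). }
  assert (Fxi : F_xi F u z = RtoC (2 * (1 + k) * Re G)).
  { unfold F_xi; rewrite Hcx, Hxi, (dzetabar_u_exp z Mz); fold k.
    transitivity ((1 + k) * (G + Cconj G));
      [rewrite HGb, Cplus_conj, Cmult_conj; unfold G|];
      apply C_ext; parts. }
  assert (Feta : F_eta F u z = RtoC (- 2 * (1 - k) * Im G)).
  { unfold F_eta; rewrite Hce, Heta, (dzetabar_u_exp z Mz); fold k.
    transitivity (Ci * (1 - k) * (G - Cconj G));
      [rewrite HGb, Cmult_conj, Cminus_conj, Cmult_conj; unfold G|];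
      apply C_ext; parts. }
  rewrite (dzetabar_u_exp z Mz), <- HGb in H; fold k in H.
  assert (H' : dzetabar (Cfun omega) z + Ci * dzetabar (Cfun theta) z
               = / 2 * (Cconj G - k * G)) by (rewrite H; unfold G; ring).
  unfold dzetabar in H'; rewrite !Cdxi_Cfun, !Cdeta_Cfun in H'.
  (* The left sides of the system are the real and imaginary parts of [2 v_zetabar]. *)
  assert (Hre : (dxi omega z - deta theta z = (1 - k) * Re G)%R).
  { apply (f_equal (fun c => 2 * Re c)%R) in H'; revert H'.
    unfold Re, Im; simpl; intros H'; field_simplify in H'; lra. }
  assert (Him : (deta omega z + dxi theta z = - (1 + k) * Im G)%R).
  { apply (f_equal (fun c => 2 * Im c)%R) in H'; revert H'.
    unfold Re, Im; simpl; intros H'; field_simplify in H'; lra. }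
  (* With this substitution [e^omega] cancels from the quotients [tanh] and [coth], leaving rational
     functions of [k]. *)
  assert (Hexp : (exp (- omega z) = k * exp (omega z))%R).
  { unfold k; rewrite <- exp_plus; f_equal; ring. }
  assert (Hx := exp_pos (omega z)).
  rewrite Hre, Him, Fxi, Feta; unfold tanh, coth, sinh, cosh; rewrite Hexp.
  split; apply C_ext; unfold Re, Im; simpl; field; repeat split; try lra; nra.
Qed.

End HarmonicDiffeomorphism.

Theorem proposition7p1 :
  forall (M N : C -> Prop) (F : C -> R) (u : C -> C) (omega theta : C -> R),
    is_domain M ->
    open N -> smooth_on N F ->
    diffeomorphism M N u ->
    harmonic_map M F u ->
    specific_coordinate M F u ->
    smooth_on M omega -> smooth_on M theta ->
    (forall z, M z ->
       Cexp (omega z + Ci * theta z) = exp (F (u z) / 2) * dzeta u z) ->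
    backlund_transform (sinh_gordon M F u) (theta_equation M F u)
      (backlund_system M F u) omega theta.
Proof.
  intros M N F u omega theta [HM _] HN HF [Hu [HuN [g [Hg [_ [Hgu _]]]]]]
    Hharm Hspec Homega Htheta Hv.
  assert (H2 := second_order M N F u omega theta HM HN HF Hu HuN Hharm Hspec
                  Homega Htheta Hv).
  assert (H0 := fun z => omega_neq_0 M N F u omega theta HM HN Hu HuN Hspec Hv
                  g z Hg Hgu).
  split; [|split]; intros z Mz.
  (* By definition of the curvature, [- K / 2] is [F_uub e^(-F)]. *)
  - destruct (H2 z Mz) as [-> _]; unfold gauss_curvature; field.
  - destruct (H2 z Mz) as [_ E].
    transitivity (2 * (Ci * dzetabar (dzeta (Cfun theta)) z)); [ring|].
    rewrite E; field.
  - split; [now apply H0|].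
    apply (first_order M N F u omega theta); auto.
Qed.
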